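(* Let $R$ be a commutative ring and let $G$ be a nilpotent group. Then the following three statements are equivalent: (1) the group ring $RG$ is additively $2$-periodic; (2) $RG$ is periodic; (3) $R$ is periodic and $G$ is locally finite.
   Context: All rings are associative with identity. An element $r$ of a ring $S$ is periodic if $r^n=r^m$ for some natural numbers $n>m\ge 1$; $S$ is a periodic ring if all its elements are periodic. $S$ is additively $2$-periodic if each of its elements is a sum of at most $2$ periodic elements of $S$. A group is locally finite if each of its finitely generated subgroups is finite.
   Formalization: The commutative ring R is assumed to be nonzero (1 ≠ 0): for R = 0 and G infinite cyclic, RG = 0 satisfies (1) and (2), but G is not locally finite, so (3) fails. *)

(* Defs.v *)
From HB Require Import structures.
From mathcomp Require Import all_boot all_order all_algebra all_classical.
From mathcomp Require Import finmap monalg.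

Set Implicit Arguments.
Unset Strict Implicit.
Unset Printing Implicit Defensive.

Import GRing.Theory.

Local Open Scope classical_set_scope.
Local Open Scope ring_scope.

Definition periodic (S : pzRingType) (r : S) : Prop :=
  exists n m : nat, (1 <= m < n)%N /\ r ^+ n = r ^+ m.

Definition periodic_ring (S : pzRingType) : Prop := forall r : S, periodic r.

Definition additively_periodic (k : nat) (S : pzRingType) : Prop :=
  forall r : S, exists s : seq S,
    [/\ (size s <= k)%N,
        forall x : S, x \in s -> periodic x
      & r = \sum_(x <- s) x].

Section Groups.
Variable G : groupType.

Definition is_subgroup (H : set G) : Prop :=
  [/\ H 1%g,
      forall x y, H x -> H y -> H (x * y)%g
    & forall x, H x -> H x^-1%g].

Definition subgroup_gen (A : set G) : set G := smallest is_subgroup A.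

Definition finitely_generated (H : set G) : Prop :=
  exists A : set G, finite_set A /\ H = subgroup_gen A.

Definition locally_finite : Prop :=
  forall H : set G, is_subgroup H -> finitely_generated H -> finite_set H.

Fixpoint lower_central (n : nat) : set G :=
  if n is n'.+1 then
    subgroup_gen [set z | exists x y, lower_central n' x /\ z = [~ x, y]%g]
  else setT.

Definition nilpotent_group : Prop := exists n, lower_central n = [set 1%g].

End Groups.

(* The type {malg R[G]} of finitely supported functions G -> R already has a
   module structure, but its library product requires a monomType (where
   x * y = 1 forces x = y = 1), which excludes groups.  The convolution
   product is therefore put on the alias group_ring R G. *)
Definition group_ring (R : nzRingType) (G : groupType) : Type := {malg R[G]}.

HB.instance Definition _ (R : nzRingType) (G : groupType) :=
  GRing.Lmodule.on (group_ring R G).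

Section GroupRing.
Variables (R : nzRingType) (G : groupType).
Implicit Types a b c : group_ring R G.

Definition gr_one : group_ring R G := << 1 *g 1%g >>.

Definition gr_mul a b : group_ring R G :=
  \sum_(x <- msupp a) \sum_(y <- msupp b) << a@_x * b@_y *g (x * y)%g >>.

Lemma gr_mulw (d1 d2 : {fset G}) a b :
  (msupp a `<=` d1)%fset -> (msupp b `<=` d2)%fset ->
  gr_mul a b =
    \sum_(x <- d1) \sum_(y <- d2) << a@_x * b@_y *g (x * y)%g >>.
Proof.
move=> le_d1 le_d2; rewrite /gr_mul (big_fset_incl _ le_d1) /=.
  apply/eq_bigr=> x _; apply/big_fset_incl => // y _ /mcoeff_outdom ->.
  by rewrite mulr0 monalgU0.
move=> x _ /mcoeff_outdom ax.
by rewrite big1 // => y _; rewrite ax mul0r monalgU0.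
Qed.

Lemma gr_mul0 : right_zero 0 gr_mul.
Proof. by move=> a; rewrite /gr_mul big1 // => x _; rewrite msupp0 big_seq_fset0. Qed.

Lemma gr_0mul : left_zero 0 gr_mul.
Proof. by move=> a; rewrite /gr_mul msupp0 big_seq_fset0. Qed.

Lemma gr_mulU (r s : R) (x y : G) :
  gr_mul << r *g x >> << s *g y >> = << r * s *g (x * y)%g >>.
Proof. by rewrite (gr_mulw msuppU_le msuppU_le) !big_seq_fset1 !mcoeffUU. Qed.

Lemma gr_mulDl : left_distributive gr_mul +%R.
Proof.
move=> a b c.
rewrite (gr_mulw (msuppD_le a b) (fsubset_refl (msupp c))).
rewrite (gr_mulw (fsubsetUl _ (msupp b)) (fsubset_refl (msupp c))).
rewrite (gr_mulw (fsubsetUr (msupp a) _) (fsubset_refl (msupp c))).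
rewrite -big_split /=; apply/eq_bigr=> x _.
rewrite -big_split /=; apply/eq_bigr=> y _.
by rewrite mcoeffD mulrDl monalgUD.
Qed.

Lemma gr_mulDr : right_distributive gr_mul +%R.
Proof.
move=> c a b.
rewrite (gr_mulw (fsubset_refl (msupp c)) (msuppD_le a b)).
rewrite (gr_mulw (fsubset_refl (msupp c)) (fsubsetUl _ (msupp b))).
rewrite (gr_mulw (fsubset_refl (msupp c)) (fsubsetUr (msupp a) _)).
rewrite -big_split /=; apply/eq_bigr=> x _.
rewrite -big_split /=; apply/eq_bigr=> y _.
by rewrite mcoeffD mulrDr monalgUD.
Qed.

Lemma gr_mul_suml (I : Type) (s : seq I) (F : I -> group_ring R G) c :
  gr_mul (\sum_(i <- s) F i) c = \sum_(i <- s) gr_mul (F i) c.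
Proof.
exact: (big_morph (gr_mul^~ c) (fun a b => gr_mulDl a b c) (gr_0mul c)).
Qed.

Lemma gr_mul_sumr (I : Type) (s : seq I) (F : I -> group_ring R G) c :
  gr_mul c (\sum_(i <- s) F i) = \sum_(i <- s) gr_mul c (F i).
Proof.
exact: (big_morph (gr_mul c) (fun a b => gr_mulDr c a b) (gr_mul0 c)).
Qed.

Lemma gr_mulA : associative gr_mul.
Proof.
move=> a b c; rewrite [a]monalgE (gr_mul_suml _ _ (gr_mul b c)).
rewrite (gr_mul_suml _ _ b) (gr_mul_suml _ _ c); apply/eq_bigr=> x _.
set u := << _ *g x >>; rewrite [b]monalgE (gr_mul_suml _ _ c).
rewrite !(gr_mul_sumr _ _ u) (gr_mul_suml _ _ c); apply/eq_bigr=> y _.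
set v := << _ *g y >>; rewrite [c]monalgE (gr_mul_sumr _ _ v).
rewrite (gr_mul_sumr _ _ u) (gr_mul_sumr _ _ (gr_mul u v)).
by apply/eq_bigr=> z _; rewrite !gr_mulU mulrA mulgA.
Qed.

Lemma gr_mul1 : right_id gr_one gr_mul.
Proof.
move=> a; rewrite [a]monalgE gr_mul_suml; apply/eq_bigr=> x _.
by rewrite gr_mulU mulr1 mulg1.
Qed.

Lemma gr_1mul : left_id gr_one gr_mul.
Proof.
move=> a; rewrite [a]monalgE gr_mul_sumr; apply/eq_bigr=> x _.
by rewrite gr_mulU mul1r mul1g.
Qed.

Lemma gr_one_neq0 : gr_one != 0.
Proof. by rewrite monalgU_eq0 oner_eq0. Qed.

HB.instance Definition _ := GRing.Zmodule_isNzRing.Build (group_ring R G)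
  gr_mulA gr_1mul gr_mul1 gr_mulDl gr_mulDr gr_one_neq0.

End GroupRing.

(* Main.v *)
(* The substance is (1) => (3). Additive 2-periodicity passes to the quotient
   R[G/G'], which is commutative. In a ring where 3 = a + b with a, b periodic
   some positive integer vanishes, because two complex numbers of norm at most 1
   cannot add up to 3; and in a commutative ring of positive characteristic
   finitely many periodic elements generate a finite subring. So R[G/G'] is
   periodic, whence R is periodic and G/G' is torsion. Commutators carry
   torsion down the lower central series, each of whose factors is thus
   torsion, and Schreier's argument, applied from the bottom of the series
   upwards, makes every finitely generated subgroup finite.
   For (3) => (2), an element of RG lies in the additive span of a finite
   multiplicative monoid, built from its coefficients and a finite subgroup. *)
Require Import Defs.
From HB Require Import structures.
From mathcomp Require Import all_boot all_order all_algebra all_field.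
From mathcomp Require Import all_classical.
From mathcomp Require Import finmap monalg generic_quotient.

Set Implicit Arguments.
Unset Strict Implicit.
Unset Printing Implicit Defensive.

Import Order.TTheory GRing.Theory Num.Theory.

Local Open Scope classical_set_scope.
Local Open Scope quotient_scope.
Local Open Scope ring_scope.

(** * Periodic elements, additive spans and finite monoids in a ring *)

Section Periodic.
Variable S : pzRingType.
Implicit Types (c r x y : S) (M : set S).

Lemma periodic_of_finite_powers (A : set S) r :
  finite_set A -> (forall k, A (r ^+ k.+1)) -> periodic r.
Proof.
move=> finA Ar; apply: contrapT => nper; apply: infinite_nat.
pose f k := r ^+ k.+1.
have f_lt i j : (i < j)%N -> f i <> f j.
  by move=> ltij eij; apply: nper; exists j.+1, i.+1.
have f_inj : injective f.
  by move=> i j eij; case: (ltngtP i j) => // /f_lt; rewrite eij.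
apply: (@sub_finite_set _ _ (f @^-1` A)) => [k _|]; first exact: Ar.
by apply: finite_preimage finA => i j _ _; apply: f_inj.
Qed.

Lemma periodic0 : periodic (0 : S).
Proof. by exists 2%N, 1%N; rewrite expr0n expr1. Qed.

Definition mul_closed M := forall x y, M x -> M y -> M (x * y).

(** Sums carry no signs: when a positive [N] vanishes in [S], [- x] is [x *+ N.-1], so this is
    already the additive subgroup generated by [M]. *)
Definition add_span M : set S :=
  [set \sum_(x <- s) x | s in [set s : seq S | forall x, x \in s -> M x]].

Lemma add_span_mul_closed M : mul_closed M -> mul_closed (add_span M).
Proof.
move=> Mmul _ _ [s Ms <-] [t Mt <-].
exists [seq x * y | x <- s, y <- t].
  move=> _ /allpairsP[[x y] /= [xs yt ->]].
  by apply: Mmul; [apply: Ms|apply: Mt].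
rewrite big_allpairs_dep mulr_suml; apply: eq_bigr => x _.
by rewrite mulr_sumr.
Qed.

(** [A] consists of the combinations of the entries of [t] with coefficients below [N]. Containing 0
    and absorbing entries of [t], it contains every sum of such entries. *)
Lemma finite_add_invariant N (t : seq S) : (0 < N)%N -> N%:R = 0 :> S ->
  exists A : set S, [/\ finite_set A, A 0
    & forall x y, x \in t -> A y -> A (x + y)].
Proof.
move=> N_gt0 N0; elim: t => [|x t [A [finA A0 AD]]].
  by exists [set 0]; split=> //; apply: finite_set1.
exists [set x *+ n + y | n in `I_N & y in A]; split.
- exact: finite_image2 (finite_II N) finA.
- by exists 0%N => //; exists 0; rewrite // addr0.
move=> z _ + [n ltnN [y Ay <-]]; rewrite inE => /predU1P[->|zt].
  exists (n.+1 %% N)%N; first by rewrite /= ltn_mod.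
  exists y => //; rewrite addrA -mulrS {2}(divn_eq n.+1 N) mulrnDr.
  by rewrite mulnC mulrnA -(mulr_natr x N) N0 mulr0 mul0rn add0r.
by exists n => //; exists (z + y); [apply: AD|rewrite addrCA].
Qed.

Lemma finite_add_span N M : (0 < N)%N -> N%:R = 0 :> S ->
  finite_set M -> finite_set (add_span M).
Proof.
move=> N_gt0 N0 /finite_seqP[t Mt].
have [A [finA A0 AD]] := finite_add_invariant t N_gt0 N0.
apply: (sub_finite_set _ finA) => _ [s Ms <-].
elim: s Ms => [|x s IHs] Ms; first by rewrite big_nil.
rewrite big_cons; apply: AD.
  by have := Ms x (mem_head _ _); rewrite Mt.
by apply: IHs => y ys; apply: Ms; rewrite inE ys orbT.
Qed.

Lemma periodic_add_span N M r : (0 < N)%N -> N%:R = 0 :> S ->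
  finite_set M -> mul_closed M -> add_span M r -> periodic r.
Proof.
move=> N_gt0 N0 finM Mmul Mr.
apply: (periodic_of_finite_powers (finite_add_span N_gt0 N0 finM)).
elim=> [|k IHk]; first by rewrite expr1.
by rewrite exprS; apply: add_span_mul_closed.
Qed.

(** Counting up, an exponent that reaches [n] falls back to [m]. *)
Lemma expr_bounded c n m k : (m < n)%N -> c ^+ n = c ^+ m ->
  exists2 g, (g < n)%N & c ^+ k = c ^+ g.
Proof.
move=> ltmn cnm; elim: k => [|k [g ltgn ckg]].
  by exists 0%N => //; apply: leq_ltn_trans ltmn.
have [ltgn1|] := ltnP g.+1 n; first by exists g.+1; rewrite // !exprS ckg.
by move=> lengs; exists m; rewrite // -cnm exprS ckg -exprS; congr (_ ^+ _);
  apply/eqP; rewrite eqn_leq ltgn.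
Qed.

(** The products [c ^+ e * x] with [e < n] and [x] in [M] form such a set. Only [c] has to be
    central, so [M] may come from a noncommutative group. *)
Lemma adjoin_central_periodic M c :
    finite_set M -> M 1 -> mul_closed M ->
    periodic c -> (forall x, GRing.comm c x) ->
  exists M', [/\ finite_set M', M `<=` M', M' c & mul_closed M'].
Proof.
move=> finM M1 Mmul [n [m [/andP[_ ltmn] cnm]]] cC.
have c_le k : exists2 g, (g < n)%N & c ^+ k = c ^+ g by apply: expr_bounded cnm.
exists [set c ^+ e * x | e in `I_n & x in M]; split.
- exact: finite_image2 (finite_II n) finM.
- move=> x Mx; exists 0%N; first by apply: leq_ltn_trans ltmn.
  by exists x; rewrite // mul1r.
- by have [g ltgn cg] := c_le 1%N; exists g => //; exists 1; rewrite // mulr1 -cg.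
move=> _ _ [e _ [x Mx <-]] [f _ [y My <-]].
have [g ltgn cg] := c_le (e + f)%N; exists g => //; exists (x * y).
  exact: Mmul.
rewrite -cg exprD -!mulrA; congr (_ * _); rewrite !mulrA; congr (_ * _).
exact/commr_sym/commrX/commr_sym.
Qed.

Lemma adjoin_central_periodic_seq M (s : seq S) :
    finite_set M -> M 1 -> mul_closed M ->
    (forall c, c \in s -> periodic c) ->
    (forall c x, c \in s -> GRing.comm c x) ->
  exists M', [/\ finite_set M', M `<=` M', forall c, c \in s -> M' c
               & mul_closed M'].
Proof.
move=> finM M1 Mmul; elim: s => [|c s IHs] sper sC; first by exists M; split.
case: IHs => [x xs|x y xs|M' [finM' sMM' sM' M'mul]].
- by apply: sper; rewrite inE xs orbT.
- by apply: sC; rewrite inE xs orbT.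
have [||M2 [finM2 sM2 M2c M2mul]] :=
    @adjoin_central_periodic M' c finM' (sMM' _ M1) M'mul.
- exact/sper/mem_head.
- by move=> x; apply/sC/mem_head.
exists M2; split=> // [x /sMM'/sM2 //|x]; rewrite inE => /predU1P[->//|xs].
exact/sM2/sM'.
Qed.

End Periodic.

(** * Positive characteristic, and the commutative case *)

Lemma norm_le1_of_expr_eq (K : numDomainType) (x : K) n m :
  (m < n)%N -> x ^+ n = x ^+ m -> `|x| <= 1.
Proof.
move=> ltmn /(congr1 Num.norm); rewrite !normrX => eqx.
rewrite real_leNgt ?realE ?normr_ge0 ?ler01 //; apply/negP => lt1x.
by have := ltr_eXn2l lt1x m n; rewrite eqx ltxx ltmn.
Qed.

(** Clearing denominators in a rational Bezout relation leaves integer coefficients, which can be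
    evaluated in any ring. *)
Lemma int_Bezout_of_coprimep (p q : {poly int}) :
    coprimep (map_poly (intr : int -> rat) p) (map_poly intr q) ->
  exists2 N : int, N != 0 & exists u v, u * p + v * q = N%:P.
Proof.
case/Bezout_eq1_coprimepP => -[u v] /=.
have [u' [a a0 ->]] := rat_poly_scale u; have [v' [b b0 ->]] := rat_poly_scale v.
move=> eq1; exists (a * b); first by rewrite mulf_neq0.
exists (b *: u'), (a *: v').
have inj : injective (map_poly (intr : int -> rat)).
  by apply/map_inj_poly => //; apply: intr_inj.
apply: inj; rewrite rmorphD !rmorphM /= !map_polyZ !map_polyC /= -polyCM.
have [a1 b1]: (a%:~R : rat) != 0 /\ (b%:~R : rat) != 0 by rewrite !intr_eq0.
rewrite -[RHS]mulr1 -eq1 mulrDr.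
rewrite -!mul_polyC !mulrA -!polyCM; congr (_%:P * _ * _ + _%:P * _ * _).
  by rewrite mulrAC mulfV ?mul1r.
by rewrite -mulrA mulfV ?mulr1.
Qed.

(* The integer polynomials X^n - X^m and (3 - X)^n' - (3 - X)^m' vanish at a.
   At a common complex root x, both x and 3 - x would have norm at most 1, so
   they are coprime over the rationals, and a Bezout relation evaluated at a
   kills a nonzero integer. *)
Lemma natr0_of_periodic_sum3 (S : nzRingType) (a b : S) :
    a + b = 3%:R -> periodic a -> periodic b ->
  exists2 N, (0 < N)%N & N%:R = 0 :> S.
Proof.
move=> ab [n [m [/andP[_ ltmn] anm]]] [n' [m' [/andP[_ ltmn'] bnm]]].
pose p : {poly int} := 'X^n - 'X^m.
pose y : {poly int} := 3%:P - 'X; pose q := y ^+ n' - y ^+ m'.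
have [|N N0 [u [v uv]]] := @int_Bezout_of_coprimep p q.
  rewrite -(coprimep_map (ratr : {rmorphism rat -> algC})).
  apply/Pdiv.ClosedField.coprimepP => x.
  rewrite /p /q /y !rmorphB !rmorphXn /= !rmorphB /= !map_polyX !map_polyC /=.
  rewrite /root !hornerE subr_eq0 => /eqP/(norm_le1_of_expr_eq ltmn) x_le1.
  apply/negP; rewrite subr_eq0 => /eqP/(norm_le1_of_expr_eq ltmn').
  rewrite !rmorph_nat => y_le1.
  have := ler_normD x (3 - x); rewrite addrC subrK normr_nat => le3.
  by have := le_trans le3 (lerD x_le1 y_le1); rewrite -[1 + 1]/(2%:R) ler_nat.
(* Integers are central in [S], so evaluation at [a] is a ring morphism even if [S] is not
   commutative. *)
have aC : commr_rmorph (intr : int -> S) a by move=> i; apply: commr_int.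
have := congr1 (horner_morph aC) uv.
rewrite rmorphD !rmorphM /= /p /q /y !rmorphB !rmorphXn /= !rmorphB /=.
rewrite !horner_morphX !horner_morphC /= anm subrr mulr0 add0r.
have -> : 3%:~R - a = b by rewrite -[3%:~R]/(3%:R) -ab addrC addKr.
rewrite bnm subrr mulr0 => /esym NS.
exists `|N|%N; first by rewrite absz_gt0.
case: (intP N) NS N0 => [|k|k] // NS _.
by move/eqP: NS; rewrite abszN mulrNz oppr_eq0 => /eqP.
Qed.

Lemma natr0_of_periodic_ring (S : nzRingType) :
  periodic_ring S -> exists2 N, (0 < N)%N & N%:R = 0 :> S.
Proof.
move=> /(_ 2%:R) [n [m [/andP[_ ltmn] eq2]]].
exists (2 ^ n - 2 ^ m)%N; first by rewrite subn_gt0 ltn_exp2l.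
by rewrite natrB ?leq_exp2l ?(ltnW ltmn) // !natrX eq2 subrr.
Qed.

Lemma periodic_ring_of_additively2_periodic (S : nzRingType) :
  (forall x y : S, GRing.comm x y) -> additively_periodic 2 S -> periodic_ring S.
Proof.
move=> SC S2.
have [N N_gt0 N0] : exists2 N, (0 < N)%N & N%:R = 0 :> S.
  (* An empty sum makes 3 itself vanish; a single summand is padded with the periodic element 0. *)
  have [[|a [|b [|c s]]] [//= _ sper eq3]] := S2 3%:R.
  - by exists 3%N; rewrite // eq3 big_nil.
  - apply: (@natr0_of_periodic_sum3 _ a 0); last exact: periodic0.
      by rewrite eq3 big_seq1 addr0.
    exact/sper/mem_head.
  - apply: (@natr0_of_periodic_sum3 _ a b).
    + by rewrite eq3 big_cons big_seq1.
    + by apply: sper; rewrite !inE eqxx.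
    + by apply: sper; rewrite !inE eqxx orbT.
move=> r; have [s [_ sper ->]] := S2 r.
have [|x y -> ->|c x _|M [finM _ sM Mmul]] :=
    @adjoin_central_periodic_seq S [set 1] s _ erefl _ sper.
- exact: finite_set1.
- by rewrite /= mulr1.
- exact: SC.
by apply: (periodic_add_span N_gt0 N0 finM Mmul); exists s.
Qed.

(** * Lower central series, torsion factors and local finiteness *)

Section Subgroups.
Variable G : groupType.
Implicit Types (x y z : G) (A H N : set G).

Lemma subgroup_gen_is_subgroup A : is_subgroup (subgroup_gen A).
Proof.
split.
- by move=> H [[]].
- move=> x y Ax Ay H HA; have [[_ HM _] _] := HA.
  by apply: HM; [apply: Ax|apply: Ay].
- by move=> x Ax H HA; have [[_ _ HV] _] := HA; apply: HV; apply: Ax.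
Qed.

Lemma sub_subgroup_gen A : A `<=` subgroup_gen A.
Proof. exact: sub_gen_smallest. Qed.

Lemma lower_central_is_subgroup n : is_subgroup (@lower_central G n).
Proof. by case: n => [|n] //; apply: subgroup_gen_is_subgroup. Qed.

Lemma lower_central_commg n x y :
  lower_central n x -> lower_central n.+1 [~ x, y]%g.
Proof. by move=> nx; apply: sub_subgroup_gen; exists x, y. Qed.

Lemma lower_centralS n : @lower_central G n.+1 `<=` lower_central n.
Proof.
elim: n => [x _ //|n IHn].
apply: smallest_sub; first exact: lower_central_is_subgroup.
by move=> _ [x [y [nx ->]]]; apply: lower_central_commg; apply: IHn.
Qed.

Lemma lower_central_conj n x y : lower_central n x -> lower_central n (x ^ y)%g.
Proof.
move=> nx; have -> : (x ^ y = x * [~ x, y])%g by rewrite commgEl mulVKg.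
have [_ nM _] := lower_central_is_subgroup n.
by apply: nM => //; apply: lower_centralS; apply: lower_central_commg.
Qed.

(** [Q] is the set of cosets of [N], multiplied through representatives; invariance under
    conjugation makes this independent of the representatives. *)
Lemma quotient_group N :
    is_subgroup N -> (forall x y, N x -> N (x ^ y)%g) ->
  exists (Q : groupType) (f : UMagmaMorphism.type G Q),
    (forall q, exists x, f x = q) /\ (forall x, f x = 1%g <-> N x).
Proof.
move=> [N1 NM NV] NJ.
pose r x y := `[< N (x^-1 * y)%g >].
have r_refl : reflexive r by move=> x; apply/asboolP; rewrite mulVg.
have rV x y : r x y -> r y x.
  by move=> /asboolP/NV; rewrite invgM invgK => Nyx; apply/asboolP.
have r_sym : symmetric r by move=> x y; apply/idP/idP; apply: rV.
have r_trans : transitive r.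
  move=> y x z /asboolP xy /asboolP yz; apply/asboolP.
  by have := NM _ _ xy yz; rewrite mulgA mulgK.
pose e := EquivRel r r_refl r_sym r_trans.
pose T := {eq_quot e}; pose f x : T := \pi x.
have fP x y : f x = f y <-> N (x^-1 * y)%g.
  by split=> [/eqmodP/asboolP//|Nxy]; apply/eqmodP/asboolP.
have reprE x : N (x^-1 * repr (f x))%g by apply/fP; rewrite /f reprK.
have frepr (q : T) : f (repr q) = q by rewrite /f reprK.
pose mul (p q : T) : T := f (repr p * repr q)%g.
pose inv (p : T) : T := f (repr p)^-1%g.
have fM x y : mul (f x) (f y) = f (x * y)%g.
  apply/esym/fP; set a := repr _; set b := repr _.
  have -> : ((x * y)^-1 * (a * b) = (x^-1 * a) ^ y * (y^-1 * b))%g.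
    by rewrite conjgE invgM !mulgA mulgK.
  by apply: NM; [apply/NJ/reprE|apply: reprE].
have fV x : inv (f x) = f x^-1%g.
  apply/fP; rewrite invgK; set a := repr _.
  have -> : (a * x^-1 = (x^-1 * a) ^ x^-1)%g.
    by rewrite conjgE invgK !mulgA mulgV mul1g.
  exact/NJ/reprE.
have mulA : associative mul.
  by move=> p q s; rewrite -(frepr p) -(frepr q) -(frepr s) !fM mulgA.
have mul1 : left_id (f 1%g) mul.
  by move=> p; rewrite -(frepr p) fM mul1g.
have mulr1 : right_id (f 1%g) mul.
  by move=> p; rewrite -(frepr p) fM mulg1.
have mulVl : left_inverse (f 1%g) inv mul.
  by move=> p; rewrite -(frepr p) fV fM mulVg.
have mulVr : right_inverse (f 1%g) inv mul.
  by move=> p; rewrite -(frepr p) fV fM mulgV.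
pose gT := isGroup.Build T mulA mul1 mulr1 mulVl mulVr.
pose Q : groupType := HB.pack T gT.
pose fm := isUMagmaMorphism.Build G Q f (erefl, fun x y => esym (fM x y)).
pose F : UMagmaMorphism.type G Q := HB.pack f fm.
exists Q, F; split=> [q|x]; first by exists (repr q); apply: frepr.
split=> [/esym/fP|Nx]; first by rewrite invg1 mul1g.
by apply/esym/fP; rewrite invg1 mul1g.
Qed.

Lemma lower_central_quotient n :
  exists (Q : groupType) (f : UMagmaMorphism.type G Q),
    (forall q, exists x, f x = q) /\ (forall x, f x = 1%g <-> lower_central n x).
Proof.
apply: quotient_group; first exact: lower_central_is_subgroup.
exact: lower_central_conj.
Qed.

(** For a normal subgroup [N] of a group [A], this says that [A / N] is torsion. *)
Definition torsion_mod A N := forall x, A x -> exists2 n, (0 < n)%N & N (x ^+ n)%g.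

(** Modulo [lower_central i.+2] the commutators [[~ x, y]] with [x] in [lower_central i] are
    central, so [[~ x, y] ^+ n] becomes [[~ x ^+ n, y]]. This is trivial once [x ^+ n] lies in
    [lower_central i.+1]. *)
Lemma lower_central_torsion_modS i :
    torsion_mod (lower_central i) (lower_central i.+1) ->
  torsion_mod (lower_central i.+1) (lower_central i.+2).
Proof.
move=> tor; have [Q [f [_ fker]]] := lower_central_quotient i.+2.
have fC x y : lower_central i.+1 x -> commute (f x) (f y).
  move=> ix; apply/commgP/eqP; rewrite -gmulfR.
  by apply/fker; apply: lower_central_commg.
(* Membership in [lower_central i.+1] is kept because closure under products relies on its image
   being central. *)
pose X z := lower_central i.+1 z /\ exists2 n, (0 < n)%N & (f z ^+ n = 1)%g.
suff sX : lower_central i.+1 `<=` X.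
  by move=> x /sX[_ [n n_gt0 fxn]]; exists n => //; apply/fker; rewrite gmulfXn.
have [i1 iM iV] := lower_central_is_subgroup i.+1.
apply: smallest_sub => [|_ [x [y [ix ->]]]].
  split=> [|x y [ix [n n_gt0 fxn]] [iy [m m_gt0 fym]]|x [ix [n n_gt0 fxn]]].
  - by split=> //; exists 1%N; rewrite // gmulf1 expg1n.
  - split; first exact: iM.
    exists (n * m)%N; first by rewrite muln_gt0 n_gt0.
    rewrite gmulfM expgMn; last exact: fC.
    by rewrite {1}expgnA fxn mulnC expgnA fym !expg1n mulg1.
  - split; first exact: iV.
    by exists n; rewrite // gmulfV expVgn fxn invg1.
have ixy : lower_central i.+1 [~ x, y]%g by apply: lower_central_commg.
split=> //; have [n n_gt0 ixn] := tor x ix; exists n => //.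
have xy_pow : ([~ f (x ^+ n), f y] = f [~ x, y] ^+ n)%g.
  rewrite commgEl gmulfXn conjXg.
  have -> : (f x ^ f y = f x * f [~ x, y])%g by rewrite gmulfR commgEl mulVKg.
  by rewrite expgMn ?mulKg //; apply/commute_sym/fC.
by rewrite -xy_pow -gmulfR; apply/fker; apply: lower_central_commg.
Qed.

(* Schreier's argument: if the finite set T meets all cosets of the normal
   subgroup N = lower_central i.+1 in the group generated by A, that group is
   contained in K T, where K is generated by the finitely many elements
   t a t'^-1 of N with t, t' in T and a or a^-1 in A. *)
Lemma finite_subgroup_gen_lower_central i :
    torsion_mod (lower_central i) (lower_central i.+1) ->
    (forall A, finite_set A -> A `<=` lower_central i.+1 ->
       finite_set (subgroup_gen A)) ->
  forall A, finite_set A -> A `<=` lower_central i -> finite_set (subgroup_gen A).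
Proof.
move=> tor IH A /finite_seqP[s ->{A}] si.
have [Q [f [_ fker]]] := lower_central_quotient i.+1.
have fC x y : lower_central i x -> commute (f x) (f y).
  move=> ix; apply/commgP/eqP; rewrite -gmulfR.
  by apply/fker; apply: lower_central_commg.
pose l := s ++ [seq x^-1%g | x <- s].
have [_ _ iV] := lower_central_is_subgroup i.
have li x : x \in l -> lower_central i x.
  by rewrite mem_cat => /orP[/si//|/mapP[y /si iy ->]]; apply: iV.
(* [T] consists of ordered products of powers of the entries of [l]. Their images under [f] are
   central and of finite order, so a new factor moves to its place and its exponent is reduced. *)
have [T [finT T1 TM]] : exists T : set G, [/\ finite_set T, T 1%g
    & forall t a, T t -> a \in l -> exists2 t', T t' & f (t * a)%g = f t'].
  elim: l li => [|h l IHl] li.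
    by exists [set 1%g]; split=> //; apply: finite_set1.
  have [x xl|T [finT T1 TM]] := IHl.
    by apply: li; rewrite inE xl orbT.
  have ih : lower_central i h by apply/li/mem_head.
  have [n n_gt0 /fker fhn] := tor h ih.
  exists [set (h ^+ e * t)%g | e in `I_n & t in T]; split.
  - exact: finite_image2 (finite_II n) finT.
  - by exists 0%N => //; exists 1%g; rewrite // mulg1.
  move=> _ a [e lten [t Tt <-]]; rewrite inE => /predU1P[->|al].
    exists (h ^+ (e.+1 %% n) * t)%g.
      by exists (e.+1 %% n)%N; [rewrite /= ltn_mod|exists t].
    rewrite !gmulfM !gmulfXn -mulgA -(fC h t ih) mulgA -expgSr.
    rewrite {1}(divn_eq e.+1 n) expgnDr mulnC expgnA -(gmulfXn f n) fhn.
    by rewrite expg1n mul1g.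
  have [t' Tt' tat'] := TM t a Tt al; exists (h ^+ e * t')%g.
    by exists e => //; exists t'.
  by rewrite -mulgA !(gmulfM (h ^+ e)%g) tat'.
pose Z := [set z | lower_central i.+1 z /\
  exists t a t', [/\ T t, a \in l, T t' & z = (t * a * t'^-1)%g]].
have finZ : finite_set Z.
  pose TA : set G := [set (t * a)%g | t in T & a in [set` l]].
  pose Z0 : set G := [set (ta * t'^-1)%g | ta in TA & t' in T].
  apply: (@sub_finite_set _ _ Z0); last first.
    by apply: finite_image2 => //; apply: finite_image2 => //; apply: finite_seq.
  move=> _ [_ [t [a [t' [Tt al Tt' ->]]]]].
  by exists (t * a)%g; [exists t => //; exists a|exists t'].
pose K := subgroup_gen Z.
have finK : finite_set K by apply: IH => // z [].
have [K1 KM KV] := subgroup_gen_is_subgroup Z.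
pose W : set G := [set (k * t)%g | k in K & t in T].
have finW : finite_set W by apply: finite_image2.
(* Rewrite [k * t * a] as [(k * (t * a * t'^-1)) * t'], whose bracket lies in [K]. *)
have WM w a : W w -> a \in l -> W (w * a)%g.
  move=> [k Kk [t Tt <-]] al; have [t' Tt' tat'] := TM t a Tt al.
  exists (k * (t * a * t'^-1))%g; last first.
    by exists t'; rewrite // -!mulgA mulVg mulg1.
  apply: KM => //; apply: sub_subgroup_gen; split; last by exists t, a, t'.
  by apply/fker; rewrite gmulfM gmulfV tat' mulgV.
(* Treating [y] and its inverse together makes [X] a subgroup. *)
pose X y := forall w, W w -> W (w * y)%g /\ W (w * y^-1)%g.
have sX : subgroup_gen [set` s] `<=` X.
  apply: smallest_sub => [|x /= xs w Ww]; last first.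
    split; apply: WM; rewrite // mem_cat ?xs //.
    by apply/orP; right; apply: map_f.
  split=> [w Ww|x y Xx Xy w Ww|x Xx w Ww].
  - by rewrite invg1 mulg1.
  - split; first by rewrite mulgA; apply Xy; apply Xx.
    by rewrite invgM mulgA; apply Xx; apply Xy.
  - by rewrite invgK and_comm; apply: Xx.
apply: (sub_finite_set _ finW) => x /sX Xx.
rewrite -[x]mul1g; apply Xx; exists 1%g => //.
by exists 1%g; rewrite // mulg1.
Qed.

Lemma locally_finite_nilpotent :
    nilpotent_group G ->
    torsion_mod (lower_central 0) (@lower_central G 1) ->
  locally_finite G.
Proof.
move=> [c c1] tor0 H _ [A [finA ->]].
have tor i : torsion_mod (lower_central i) (@lower_central G i.+1).
  by elim: i => [|i IHi]; [|apply: lower_central_torsion_modS].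
(* [k] is the distance to the trivial term [lower_central c], so induction on [k] climbs the
   series. *)
suff fin k i : (i + k = c)%N -> forall B : set G, finite_set B -> B `<=` lower_central i ->
    finite_set (subgroup_gen B).
  by apply: (fin c 0%N) => // x _.
elim: k i => [|k IHk] i ik.
  move=> B _ sB; apply: (sub_finite_set _ (finite_set1 (1%g : G))).
  rewrite -c1 -ik addn0; apply: smallest_sub => //.
  exact: lower_central_is_subgroup.
by apply: finite_subgroup_gen_lower_central => //; apply: IHk; rewrite addSnnS.
Qed.

End Subgroups.

(** * Monomials in a group ring *)

Section GroupRingLemmas.
Variables (R : nzRingType) (G : groupType).

Lemma gr_mulE (a b : group_ring R G) : a * b = gr_mul a b.
Proof. by []. Qed.

Lemma gr_natr n : (n%:R : group_ring R G) = << n%:R *g 1%g >>.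
Proof. by rewrite (raddfMn (mkmalgU (1%g : G))). Qed.

Lemma gr_expU (c : R) (x : G) n :
  (<< c *g x >> : group_ring R G) ^+ n = << c ^+ n *g (x ^+ n)%g >>.
Proof.
elim: n => [|n IHn]; first by rewrite !expr0 expg0.
by rewrite !exprS expgS IHn gr_mulE gr_mulU.
Qed.

Lemma malgU_inj_coef (x : G) (c d : R) :
  << c *g x >> = << d *g x >> :> {malg R[G]} -> c = d.
Proof. by move/(congr1 (mcoeff x)); rewrite !mcoeffUU. Qed.

Lemma malgU_inj_supp (x y : G) :
  << 1 *g x >> = << 1 *g y >> :> {malg R[G]} -> x = y.
Proof.
move/(congr1 (mcoeff y)); rewrite mcoeffUU mcoeffU; case: eqP => // _ /eqP.
by rewrite mulr0n eq_sym oner_eq0.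
Qed.

Lemma periodic_coef : periodic_ring (group_ring R G) -> periodic_ring R.
Proof.
move=> RGper c; have [n [m [ltmn]]] := RGper << c *g 1%g >>.
rewrite !gr_expU !expg1n => /malgU_inj_coef cnm.
by exists n, m.
Qed.

Lemma torsion_of_periodic_group_ring (x : G) :
  periodic_ring (group_ring R G) -> exists2 n, (0 < n)%N & (x ^+ n = 1)%g.
Proof.
move=> RGper; have [n [m [/andP[_ ltmn]]]] := RGper << 1 *g x >>.
rewrite !gr_expU !expr1n => /malgU_inj_supp xnm.
exists (n - m)%N; first by rewrite subn_gt0.
by rewrite expgnFr 1?ltnW // xnm mulgV.
Qed.

End GroupRingLemmas.

(** * The map of group rings induced by a group morphism *)

Section GroupRingMap.
Variables (R : nzRingType) (G H : groupType) (f : UMagmaMorphism.type G H).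

Definition gr_map (a : group_ring R G) : group_ring R H :=
  \sum_(x <- msupp a) << a@_x *g f x >>.

(** Enlarging the index set lets elements with different supports be summed over a common one. *)
Lemma gr_mapw (d : {fset G}) (a : group_ring R G) : (msupp a `<=` d)%fset ->
  gr_map a = \sum_(x <- d) << a@_x *g f x >>.
Proof.
move=> le_d; apply: big_fset_incl => // x _ /mcoeff_outdom ->.
by rewrite monalgU0.
Qed.

Lemma gr_map0 : gr_map 0 = 0.
Proof. by rewrite /gr_map msupp0 big_seq_fset0. Qed.

Lemma gr_mapD : {morph gr_map : a b / a + b}.
Proof.
move=> a b; rewrite (gr_mapw (msuppD_le a b)) (gr_mapw (fsubsetUl _ (msupp b))).
rewrite (gr_mapw (fsubsetUr (msupp a) _)) -big_split /=; apply: eq_bigr => x _.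
by rewrite mcoeffD monalgUD.
Qed.

Lemma gr_map_sum (I : Type) (s : seq I) (F : I -> group_ring R G) :
  gr_map (\sum_(i <- s) F i) = \sum_(i <- s) gr_map (F i).
Proof. exact: (big_morph gr_map gr_mapD gr_map0). Qed.

Lemma gr_mapU (c : R) (x : G) : gr_map << c *g x >> = << c *g f x >>.
Proof. by rewrite (gr_mapw msuppU_le) big_seq_fset1 mcoeffUU. Qed.

Lemma gr_mapM : {morph gr_map : a b / a * b}.
Proof.
move=> a b; rewrite [a in LHS]monalgE [b in LHS]monalgE !gr_mulE.
rewrite gr_mul_suml gr_map_sum gr_mul_suml; apply: eq_bigr => x _.
rewrite gr_mul_sumr gr_map_sum gr_mul_sumr; apply: eq_bigr => y _.
by rewrite !gr_mulU gr_mapU gmulfM.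
Qed.

Lemma gr_mapX n : {morph gr_map : a / a ^+ n.+1}.
Proof. by elim: n => [//|n IHn] a; rewrite exprS gr_mapM IHn -exprS. Qed.

Lemma periodic_gr_map (a : group_ring R G) : periodic a -> periodic (gr_map a).
Proof.
move=> [[|n] [[|m] [// ltmn anm]]]; exists n.+1, m.+1; split=> //.
by rewrite -!gr_mapX anm.
Qed.

Lemma gr_map_surj : (forall q, exists x, f x = q) ->
  forall b : group_ring R H, exists a, gr_map a = b.
Proof.
move=> /choice[g fg] b.
exists (\sum_(y <- msupp b) << b@_y *g g y >>).
rewrite gr_map_sum [RHS]monalgE; apply: eq_bigr => y _.
by rewrite gr_mapU fg.
Qed.

Lemma additively_periodic_gr_map k : (forall q, exists x, f x = q) ->
  additively_periodic k (group_ring R G) -> additively_periodic k (group_ring R H).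
Proof.
move=> f_surj RGk b; have [a <-] := gr_map_surj f_surj b.
have [s [sk sper ->]] := RGk a; exists (map gr_map s); split.
- by rewrite size_map.
- by move=> _ /mapP[x /sper xper ->]; apply: periodic_gr_map.
by rewrite big_map gr_map_sum.
Qed.

End GroupRingMap.

(** * Commutative coefficients and the implications of the theorem *)

Section CommutativeCoefficients.
Variables (R : comNzRingType) (G : groupType).

Lemma gr_scalar_comm (c : R) (a : group_ring R G) :
  GRing.comm (<< c *g 1%g >> : group_ring R G) a.
Proof.
rewrite /GRing.comm !gr_mulE [a]monalgE gr_mul_suml gr_mul_sumr.
by apply: eq_bigr => x _; rewrite !gr_mulU mulrC mul1g mulg1.
Qed.

Lemma gr_comm (a b : group_ring R G) :
  (forall x y : G, commute x y) -> GRing.comm a b.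
Proof.
move=> GC; rewrite /GRing.comm !gr_mulE [a]monalgE [b]monalgE.
rewrite gr_mul_suml gr_mul_sumr; apply: eq_bigr => x _.
rewrite gr_mul_suml gr_mul_sumr; apply: eq_bigr => y _.
by rewrite !gr_mulU mulrC GC.
Qed.

End CommutativeCoefficients.

Lemma abelianization_torsion (R : comNzRingType) (G : groupType) :
  additively_periodic 2 (group_ring R G) ->
  periodic_ring R /\ torsion_mod (lower_central 0) (@lower_central G 1).
Proof.
(* [lower_central 1] is the commutator subgroup, so [Q] is the abelianization of [G]. *)
move=> RG2; have [Q [f [f_surj fker]]] := lower_central_quotient G 1.
have QC (x y : Q) : commute x y.
  have [[x' <-] [y' <-]] := (f_surj x, f_surj y).
  by apply/commgP/eqP; rewrite -gmulfR; apply/fker; apply: lower_central_commg.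
have RQper : periodic_ring (group_ring R Q).
  apply: periodic_ring_of_additively2_periodic => [a b|]; first exact: gr_comm.
  exact: additively_periodic_gr_map RG2.
split=> [|x _]; first exact: periodic_coef RQper.
have [n n_gt0 fxn] := torsion_of_periodic_group_ring (f x) RQper.
by exists n => //; apply/fker; rewrite gmulfXn.
Qed.

Lemma periodic_group_ring (R : comNzRingType) (G : groupType) :
  periodic_ring R -> locally_finite G -> periodic_ring (group_ring R G).
Proof.
move=> Rper Gfin a.
have [N N_gt0 N0] := natr0_of_periodic_ring Rper.
have N0' : N%:R = 0 :> group_ring R G by rewrite gr_natr N0 monalgU0.
pose H := subgroup_gen [set` msupp a].
have H_sub : is_subgroup H by apply: subgroup_gen_is_subgroup.
have [H1 HM _] := H_sub.
have finH : finite_set H.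
  by apply: Gfin => //; exists [set` msupp a]; split=> //; apply: finite_fset.
pose u (x : G) : group_ring R G := << 1 *g x >>.
pose v (x : G) : group_ring R G := << a@_x *g 1%g >>.
have [|||c /mapP[x _ ->]|c b /mapP[x _ ->]|M [finM sHM sM Mmul]] :=
    @adjoin_central_periodic_seq _ (u @` H) [seq v x | x <- msupp a].
- exact: finite_image.
- by exists 1%g.
- move=> _ _ [x Hx <-] [y Hy <-]; exists (x * y)%g; first exact: HM.
  by rewrite /u gr_mulE gr_mulU mulr1.
- have [n [m [ltmn cnm]]] := Rper a@_x; exists n, m; split=> //.
  by rewrite !gr_expU !expg1n cnm.
- exact: gr_scalar_comm.
apply: (periodic_add_span N_gt0 N0' finM Mmul).
exists [seq v x * u x | x <- msupp a].
  move=> _ /mapP[x xa ->]; apply: Mmul; first exact/sM/map_f.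
  by apply: sHM; exists x => //; apply: sub_subgroup_gen.
rewrite big_map [RHS]monalgE; apply: eq_bigr => x _.
by rewrite gr_mulE gr_mulU mulr1 mul1g.
Qed.

Theorem theorem2p14 (R : comNzRingType) (G : groupType)
    (nilG : nilpotent_group G) :
  [<-> additively_periodic 2 (group_ring R G);
       periodic_ring (group_ring R G);
       periodic_ring R /\ locally_finite G].
Proof.
have H13 : additively_periodic 2 (group_ring R G) ->
    periodic_ring R /\ locally_finite G.
  by move=> /abelianization_torsion[Rper /(locally_finite_nilpotent nilG)].
have H32 : periodic_ring R /\ locally_finite G -> periodic_ring (group_ring R G).
  by case; apply: periodic_group_ring.
have H21 : periodic_ring (group_ring R G) -> additively_periodic 2 (group_ring R G).
  by move=> RGper a; exists [:: a]; split=> //; rewrite big_seq1.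
(* The statement unfolds to the cycle (1) to (2) to (3) to (1), opposite to the one proved, so each
   arrow is a composite of two. *)
by split=> [/H13/H32 //|]; split=> [/H21/H13 //|/H32/H21].
Qed.
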